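(* Let $H$ be a complex Hilbert space and let $\phi : C_1^+(H) \to C_1^+(H)$ be a bijective transformation with the property that \[ F(\phi(A),\phi(B)) = F(A,B) \qquad \text{for all } A,B \in C_1^+(H). \] Then there is an operator $U : H \to H$, either unitary or antiunitary, such that \[ \phi(A) = U A U^* \qquad \text{for all } A \in C_1^+(H). \]
   Context: $C_1^+(H)$ denotes the set of all density operators on $H$, meaning here the set of all positive (i.e. positive semidefinite) bounded self-adjoint operators on $H$ with finite trace. No normalization of the trace is imposed, and the zero operator is included. For $A,B \in C_1^+(H)$ the fidelity of $A$ and $B$ is \[ F(A,B) = \operatorname{tr}\,(A^{1/2} B A^{1/2})^{1/2}, \] where square roots are the positive square roots of positive operators. An antiunitary operator is a bijective conjugate-linear map $U : H \to H$ with $\langle Ux, Uy\rangle = \langle y, x\rangle$ for all $x,y \in H$; for $U$ unitary or antiunitary, $U^* = U^{-1}$. The map $\phi$ is not assumed to be linear or continuous. *)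

(* Defs.v *)
From HB Require Import structures.
From mathcomp Require Import all_boot all_order all_algebra.
From mathcomp Require Import all_classical all_reals all_analysis.
From mathcomp Require Import complex.

Set Implicit Arguments.
Unset Strict Implicit.
Unset Printing Implicit Defensive.

Import Order.TTheory GRing.Theory Num.Theory.
Import numFieldNormedType.Exports.

Local Open Scope classical_set_scope.
Local Open Scope ring_scope.

(* A complex Hilbert space is a complete normed space over R[i] whose norm
   (which takes its values in the nonnegative reals of R[i]) is induced by an
   inner product, linear in its first argument and conjugate-linear in its
   second one.  The dimension is arbitrary and separability is not assumed. *)
HB.mixin Record CompleteNormedModule_isHilbert (R : realType) H
    & CompleteNormedModule R[i] H := {
  inner : {dot H for (@Num.conj R[i])} ;
  normr_inner : forall x : H, `|x| ^+ 2 = inner x x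
}.

#[short(type="hilbertType")]
HB.structure Definition Hilbert (R : realType) :=
  { H of CompleteNormedModule R[i] H & CompleteNormedModule_isHilbert R H }.

Notation "''[' x , y ]" := (inner x%R y%R)
  (at level 0, format "''[' x ,  y ]") : ring_scope.

Section Operators.
Context {R : realType} {H : hilbertType R}.
Implicit Types (A B S U : H -> H) (E F : set H).

Definition bounded_operator A :=
  linear A /\ exists M : R, forall x, `|A x| <= (M%:C)%C * `|x|.

Definition self_adjoint A := forall x y, '[A x, y] = '[x, A y].

(* In R[i], 0 <= z means that z is real and nonnegative. *)
Definition positive_operator A :=
  [/\ bounded_operator A, self_adjoint A & forall x, 0 <= '[A x, x]].

(* The positive square root of a positive operator (and 0 if there is none). *)
Definition op_sqrt A : H -> H :=
  xget (fun=> 0) [set S | positive_operator S /\ S \o S = A].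

Definition orthonormal_set E :=
  forall x y, E x -> E y -> '[x, y] = (x == y)%:R.

Definition orthonormal_basis E :=
  orthonormal_set E /\ forall F, orthonormal_set F -> E `<=` F -> F = E.

Lemma orthonormal_basis_exists : exists E, orthonormal_basis E.
Proof.
have [F FP totF|E [oE maxE]] := @Zorn_bigcup _ orthonormal_set.
  move=> x y [X FX Xx] [Y FY Yy].
  have [XY|YX] := totF _ _ FX FY; first exact: FP (XY _ Xx) Yy.
  exact: FP Xx (YX _ Yy).
exists E; split=> // F oF EF; apply: contrapT => FE.
by apply: (maxE F) => //; split=> // FsubE; apply: FE; apply/seteqP.
Qed.

(* The trace of a positive operator: the sum of the <A e, e> over an orthonormal
   basis, with value +oo if the sum diverges.  The sum does not depend on the
   basis, so an arbitrary one is chosen. *)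
Definition op_trace A : \bar R :=
  \esum_(e in xget set0 orthonormal_basis) (complex.Re '[A e, e])%:E.

(* F(A, B) = tr (A^(1/2) B A^(1/2))^(1/2); it is finite when A and B have a
   finite trace. *)
Definition fidelity A B : \bar R :=
  op_trace (op_sqrt (op_sqrt A \o B \o op_sqrt A)).

Definition unitary U :=
  [/\ bijective U, linear U & forall x y, '[U x, U y] = '[x, y]].

Definition antiunitary U :=
  [/\ bijective U,
      forall (a : R[i]) x y, U (a *: x + y) = (a^*)%R *: U x + U y
    & forall x y, '[U x, U y] = '[y, x]].

End Operators.

(* C_1^+(H): no normalization of the trace is imposed, and 0 is included. *)
Definition density_operators (R : realType) (H : hilbertType R) :
    set (H -> H) :=
  [set A | positive_operator A /\ (op_trace A < +oo)%E].
Arguments density_operators {R} H.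

(* Main.v *)
Require Import Defs.
From mathcomp Require Import all_boot all_order all_algebra.
From mathcomp Require Import all_classical all_reals all_analysis.
From mathcomp Require Import complex finmap ring.

Set Implicit Arguments.
Unset Strict Implicit.
Unset Printing Implicit Defensive.

Import Order.TTheory GRing.Theory Num.Theory.
Import numFieldNormedType.Exports.

Local Open Scope classical_set_scope.
Local Open Scope ring_scope.

(** Fidelity-preserving bijections come from unitaries or antiunitaries.

    Two values of the fidelity are easy to read off. For the rank-one operator
    |x><x|, sending z to <z, x> x, one has F(|x><x|, B) = sqrt <B x, x>
    ([fidelity_rank1]): the fidelity with rank-one operators is the quadratic
    form of B. And F(A, B) = 0 holds exactly when B A = 0 ([fidelity_eq0]), so
    phi preserves orthogonality of states in both directions.

    Orthogonality alone singles out the rank-one states: they are the nonzero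
    states A such that every nonzero state C orthogonal to everything that is
    orthogonal to A has the same orthogonal states as A ([minimal_ketbra],
    [minimal_rank1]). Indeed the first condition says that the support of C lies
    in the support of A. It follows that phi |x><x| = |f x><f x| for a map f of
    the space, and comparing fidelities gives |<f x, f y>| = |<x, y>|.

    Wigner's theorem ([wigner]) now provides V, unitary or antiunitary, such
    that f x is a phase multiple of V x. Since
    <phi(A) V x, V x> = <phi(A) f x, f x> = <A x, x> for every x, polarization
    yields phi(A) V = V A ([conjugation_of_quadratic_form]).

    For Wigner's theorem, fix a unit vector e. For x orthogonal to e the phase
    of f x is normalized by asking that f (e + x) be proportional to f e + U x,
    with U x proportional to f x. Comparing |<x, y>| and |1 + <x, y>| with
    their images shows that U preserves real parts of inner products. Hence U is
    real-linear, and U (i x) = i U x or - i U x with a sign that additivity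
    forces to be the same for all x. Then V z = <z, e> f e + U (z - <z, e> e),
    with <z, e> conjugated in the second case.

    Two general facts carry the computation of the fidelity. A positive bounded
    operator has a positive square root ([positive_sqrt_exists]), obtained as
    the strong limit of a monotone sequence; and maximal orthonormal sets
    satisfy Parseval's identity ([parseval]), which evaluates the trace of a
    rank-one operator in whichever basis the trace is taken. *)

(** * Inner products and positive forms *)

Section InnerProduct.
Context {R : realType} {H : hilbertType R}.
Implicit Types (x y z : H) (a c : R[i]).

Lemma innerDl x y z : '[x + y, z] = '[x, z] + '[y, z].
Proof. exact: (linearDl inner). Qed.

Lemma innerDr x y z : '[x, y + z] = '[x, y] + '[x, z].
Proof. exact: (linearDr inner). Qed.

Lemma innerNl x y : '[- x, y] = - '[x, y].
Proof. exact: (linearNl inner). Qed.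

Lemma innerNr x y : '[x, - y] = - '[x, y].
Proof. exact: (linearNr inner). Qed.

Lemma innerBl x y z : '[x - y, z] = '[x, z] - '[y, z].
Proof. by rewrite innerDl innerNl. Qed.

Lemma innerBr x y z : '[x, y - z] = '[x, y] - '[x, z].
Proof. by rewrite innerDr innerNr. Qed.

Lemma inner0l x : '[0, x] = 0.
Proof. exact: (linear0l inner). Qed.

Lemma inner0r x : '[x, 0] = 0.
Proof. exact: (linear0r inner). Qed.

Lemma innerZl a x y : '[a *: x, y] = a * '[x, y].
Proof. exact: (linearZl_LR inner). Qed.

Lemma innerZr a x y : '[x, a *: y] = a^* * '[x, y].
Proof. exact: (linearZr_LR inner). Qed.

Lemma innerC x y : '[x, y] = '[y, x]^*.
Proof. by rewrite (hermC inner) expr0 mul1r. Qed.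

Definition innerE :=
  (innerDl, innerDr, innerNl, innerNr, innerZl, innerZr, inner0l, inner0r).

Lemma innerxx x : '[x, x] = `|x| ^+ 2.
Proof. by rewrite normr_inner. Qed.

Lemma inner_ge0 x : 0 <= '[x, x].
Proof. by rewrite innerxx exprn_ge0. Qed.

Lemma inner_eq0 x : '[x, x] = 0 -> x = 0.
Proof. by move/eqP; rewrite innerxx expf_eq0 /= normr_eq0 => /eqP. Qed.

Lemma inner_neq0 x : x != 0 -> '[x, x] != 0.
Proof. by apply: contra_neq => /inner_eq0. Qed.

Lemma innerC0 x y : '[x, y] = 0 -> '[y, x] = 0.
Proof. by move=> xy0; rewrite innerC xy0 conjC0. Qed.

Lemma conjC_ge0 a : 0 <= a -> a^* = a.
Proof. by move=> a0; apply/conj_Creal; rewrite ger0_real. Qed.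

Lemma conjC_realC (r : R) : ((r%:C)%C : R[i])^* = (r%:C)%C.
Proof. by apply/conj_Creal/complex_realP; exists r. Qed.

Lemma innerxxC x : '[x, x]^* = '[x, x].
Proof. exact/conjC_ge0/inner_ge0. Qed.


Lemma add_orthogonal_sqnorm x y : '[x, y] = 0 ->
  '[x + y, x + y] = '[x, x] + '[y, y].
Proof. by move=> xy0; rewrite !innerE xy0 (innerC0 xy0) addr0 add0r. Qed.

End InnerProduct.

Section PositiveForms.
Context {R : realType} {H : hilbertType R}.
Implicit Types (x y z : H) (a c : R[i]) (A T : H -> H).

Lemma linopD T : linear T -> {morph T : x y / x + y}.
Proof. by move=> lT x y; rewrite -{1}[x]scale1r lT scale1r. Qed.

Lemma linop0 T : linear T -> T 0 = 0.
Proof. by move=> lT; apply: (addrI (T 0)); rewrite -linopD// !addr0. Qed.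

Lemma linopZ T a x : linear T -> T (a *: x) = a *: T x.
Proof. by move=> lT; rewrite -[a *: x]addr0 lT (linop0 lT) addr0. Qed.

Lemma linopN T x : linear T -> T (- x) = - T x.
Proof. by move=> lT; rewrite -scaleN1r linopZ// scaleN1r. Qed.

Lemma linopB T x y : linear T -> T (x - y) = T x - T y.
Proof. by move=> lT; rewrite linopD// linopN. Qed.

Lemma linop_comp T A : linear T -> linear A -> linear (T \o A).
Proof. by move=> lT lA a x y; rewrite /= lA lT. Qed.

Lemma self_adjoint_real T x : self_adjoint T -> '[T x, x]^* = '[T x, x].
Proof. by move=> sT; rewrite -innerC sT. Qed.

(** Positivity of the quadratic form alone: the elements of the cone of powers
    below come without a stated bound. *)
Definition psd T :=
  [/\ linear T, self_adjoint T & forall x, 0 <= '[T x, x]].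

Lemma positive_psd T : positive_operator T -> psd T.
Proof. by case=> -[lT _] sT pT. Qed.

Lemma psd_id : psd (fun x => x).
Proof. by split=> // x; exact: inner_ge0. Qed.

(** A positive operator has a Cauchy-Schwarz inequality of its own: expand the
    form at q x - z y, where z = <T x, y> and q = <T y, y>; when q = 0, exchange
    x and y or, when both diagonal values vanish, use x - z y. *)
Lemma psd_cauchy_schwarz T x y : psd T ->
  `|'[T x, y]| ^+ 2 <= '[T x, x] * '[T y, y].
Proof.
move=> [lT sT pT].
have half u v : 0 < '[T v, v] -> `|'[T u, v]| ^+ 2 <= '[T u, u] * '[T v, v].
  move=> q0; set z := '[T u, v]; set q := '[T v, v] in q0 *.
  have zC : '[T v, u] = z^* by rewrite sT -innerC.
  have qC : q^* = q by rewrite /q self_adjoint_real.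
  have := pT (q *: u - z *: v).
  rewrite (linopB _ _ lT) !(linopZ _ _ lT) !(innerBl, innerBr).
  rewrite !(innerZl, innerZr) zC qC.
  rewrite -/z -/q => ge0; rewrite -subr_ge0 -(pmulr_rge0 _ q0) normCK.
  by apply: le_trans ge0 _; rewrite le_eqVlt; apply/orP; left; apply/eqP; ring.
have TC : '[T y, x] = '[T x, y]^* by rewrite sT -innerC.
have [/half//|] := boolP (0 < '[T y, y]).
rewrite lt0r pT andbT negbK => /eqP q0.
have [/half|] := boolP (0 < '[T x, x]).
  by move=> /(_ y); rewrite TC norm_conjC mulrC.
rewrite lt0r pT andbT negbK => /eqP p0.
have := pT (x - '[T x, y] *: y).
rewrite (linopB _ _ lT) (linopZ _ _ lT) !(innerBl, innerBr).
rewrite !(innerZl, innerZr) TC p0 q0.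
rewrite !(mulr0, mul0r) => ge0; rewrite -(pmulrn_lle0 _ (isT : 0 < 2)%N).
rewrite -oppr_ge0 normCK; apply: le_trans ge0 _.
by rewrite le_eqVlt; apply/orP; left; apply/eqP; ring.
Qed.

Lemma cauchy_schwarz x y : `|'[x, y]| <= `|x| * `|y|.
Proof.
have := psd_cauchy_schwarz x y psd_id.
by rewrite !innerxx -exprMn ler_pXn2r ?nnegrE ?mulr_ge0.
Qed.

Lemma psd_eq0 T x : psd T -> '[T x, x] = 0 -> T x = 0.
Proof.
move=> psdT Tx0; apply: inner_eq0; apply/eqP.
have := psd_cauchy_schwarz x (T x) psdT.
rewrite Tx0 mul0r => le0; rewrite -normr_eq0 -sqrf_eq0.
by rewrite eq_le le0 exprn_ge0.
Qed.

(** The inequality T^2 <= M T, from Cauchy-Schwarz for the form of T at x and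
    T x. It turns weak convergence of monotone sequences into strong one. *)
Lemma psd_sqnorm_le T (M : R[i]) x : psd T -> 0 <= M ->
  (forall y, `|T y| <= M * `|y|) -> '[T x, T x] <= M * '[T x, x].
Proof.
move=> psdT M0 leM; have [->|Tx0] := eqVneq (T x) 0.
  by rewrite !innerE mulr0.
have p : 0 < '[T x, T x] by rewrite lt0r inner_neq0 ?inner_ge0.
rewrite -(ler_pM2r p) -mulrA.
have [_ _ pT] := psdT.
apply: le_trans (_ : '[T x, x] * '[T (T x), T x] <= _).
  have := psd_cauchy_schwarz x (T x) psdT.
  by rewrite ger0_norm ?inner_ge0.
rewrite mulrCA ler_wpM2l//.
have [_ sT _] := psdT.
rewrite -[leLHS]ger0_norm; last exact: pT.
apply: le_trans (cauchy_schwarz _ _) _.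
by rewrite innerxx expr2 mulrA ler_wpM2r.
Qed.

(** The values <T (x + y), S (x + y)> and
    <T (i x + y), S (i x + y)> separate the two cross terms. It also holds
    across two conjugate-linear maps, which is why it is stated with an
    arbitrary square root j of -1 in the place of i. *)
Lemma polarization (T S : H -> H) (j : R[i]) :
  j ^+ 2 = -1 ->
  {morph T : x y / x + y} -> {morph S : x y / x + y} ->
  (forall x, T ('i *: x) = j *: T x) -> (forall x, S ('i *: x) = j *: S x) ->
  (forall x, '[T x, S x] = 0) -> forall x y, '[T x, S y] = 0.
Proof.
move=> j2 TD SD Ti Si TS0 x y.
have cross u v : '[T u, S v] + '[T v, S u] = 0.
  have := TS0 (u + v).
  by rewrite TD SD !(innerDl, innerDr) !TS0 add0r addr0 addrC.
have := cross ('i *: x) y; rewrite Ti Si innerZl innerZr.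
have jC : j^* = - j.
  have /eqP := j2; rewrite -(sqrCi R[i]) eqf_sqr => /orP[]/eqP->.
    by rewrite conjCi.
  by rewrite raddfN /= conjCi.
rewrite jC mulNr -mulrBr => /eqP; rewrite mulf_eq0 => /orP[/eqP j0|].
  by move: j2; rewrite j0 expr0n /= => /esym/eqP; rewrite oppr_eq0 oner_eq0.
rewrite subr_eq0 => /eqP yx; have := cross x y.
by rewrite -yx -mulr2n => /eqP; rewrite mulrn_eq0 => /eqP.
Qed.

End PositiveForms.

(** * Convergence and the cone of powers *)

Section Convergence.
Context {R : realType} {H : hilbertType R}.
Implicit Types (u v : nat -> H) (x y l : H).

Lemma gt0_complexP (e : R[i]) : 0 < e -> exists2 r : R, 0 < r & e = r%:C%C.
Proof.
move=> e0; have /complex_realP[r er] : e \is Num.real by rewrite gtr0_real.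
by exists r => //; rewrite -ltcR -er.
Qed.

(** Convergence of a sequence of vectors is reduced to that of a bounded
    monotone sequence of reals; this serves both the quadratic forms of a
    monotone sequence of operators and the masses of growing Fourier sums. *)
Lemma cvgn_le_gap u (r : nat -> R) (M : R) :
  (forall n, r n <= M) ->
  (forall m n, (m <= n)%N -> `|u n - u m| ^+ 2 <= ((r n - r m)%:C)%C) ->
  cvgn u.
Proof.
move=> rM ur.
have supr : has_sup (range r).
  by split; [exists (r 0%N), 0%N|exists M => _ [n _ <-]; exact: rM].
apply/cauchy_cvgP/cauchy_exP => e /gt0_complexP[d d0 ->].
have [_ [N _ <-] ltN] := sup_adherent (exprn_gt0 2 d0) supr.
exists (u N); exists N => // n /= Nn; rewrite -ball_normE /=.
rewrite distrC -(ltr_pXn2r (isT : 0 < 2)%N)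
  ?nnegrE ?ler0c ?normr_ge0 ?(ltW d0)//.
apply: le_lt_trans (ur _ _ Nn) _; rewrite -rmorphXn /= ltcR ltrBlDr.
apply: (@le_lt_trans _ _ (sup (range r))); last by rewrite -ltrBlDl.
by apply: ub_le_sup; [case: supr|exists n].
Qed.

Lemma cvgn_dist u l (e : R[i]) : u n @[n --> \oo] --> l -> 0 < e ->
  exists N, forall n, (N <= n)%N -> `|u n - l| < e.
Proof.
move=> /cvgr_dist_lt ul e0; have [N _ leN] := ul _ e0.
by exists N => n Nn; rewrite distrC; apply: leN.
Qed.

Lemma cvgn_of_dist u l :
  (forall e : R[i], 0 < e ->
    exists N, forall n, (N <= n)%N -> `|u n - l| < e) ->
  u n @[n --> \oo] --> l.
Proof.
move=> ul; apply/cvgrPdist_lt => e /ul[N leN].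
by exists N => // n /= Nn; rewrite distrC leN.
Qed.

Lemma cvgn_inner_eq u v l (m : H) x y :
  u n @[n --> \oo] --> l -> v n @[n --> \oo] --> m ->
  (forall n, '[u n, y] = '[x, v n]) -> '[l, y] = '[x, m].
Proof.
move=> ul vm uv; apply/eqP; rewrite -subr_eq0 -normr_le0.
apply/ler_addgt0Pl => e e0; rewrite addr0.
have K0 : 0 < `|x| + `|y| + 1 by rewrite ltr_wpDl ?addr_ge0.
have eK : 0 < e / (`|x| + `|y| + 1) by rewrite divr_gt0.
have [N1 leN1] := cvgn_dist ul eK; have [N2 leN2] := cvgn_dist vm eK.
have := (leN1 _ (leq_maxl N1 N2), leN2 _ (leq_maxr N1 N2)) => -[le1 le2].
set n := maxn N1 N2 in le1 le2.
have -> : '[l, y] - '[x, m] = '[l - u n, y] - '[x, m - v n].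
  by rewrite innerBl innerBr uv opprB addrA subrK.
apply: le_trans (ler_normB _ _) _.
apply: (@le_trans _ _ (e / (`|x| + `|y| + 1) * (`|x| + `|y|))).
  rewrite mulrDr [leRHS]addrC lerD//.
    apply: le_trans (cauchy_schwarz _ _) _. by rewrite ler_wpM2r// ltW// distrC.
  apply: le_trans (cauchy_schwarz _ _) _.
  by rewrite mulrC ler_wpM2r// ltW// distrC.
by rewrite mulrAC ler_pdivrMr// ler_wpM2l ?lerDl// ltW.
Qed.

End Convergence.

Section SquareRoot.
Context {R : realType} {H : hilbertType R}.
Implicit Types (x y : H) (A C S T : H -> H).

(** The cone of polynomials in C with nonnegative coefficients, as operators.
    When C is positive, all its elements are positive, although products of
    positive operators need not be. *)
Inductive power_cone C : (H -> H) -> Prop :=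
| power_cone0 : power_cone C (fun=> 0)
| power_coneX k : power_cone C (iter k C)
| power_coneD S T : power_cone C S -> power_cone C T ->
    power_cone C (fun x => S x + T x)
| power_coneZ (a : R[i]) S : 0 <= a -> power_cone C S ->
    power_cone C (fun x => a *: S x).

Section PowerCone.
Variable C : H -> H.
Hypothesis C_psd : psd C.

Let C_linear : linear C. Proof. by case: C_psd. Qed.
Let C_sa : self_adjoint C. Proof. by case: C_psd. Qed.

Lemma linear_iter k : linear (iter k C).
Proof. by elim: k => // k IH a x y /=; rewrite IH C_linear. Qed.

Lemma iter_self_adjoint k : self_adjoint (iter k C).
Proof. by elim: k => // k IH x y; rewrite iterS C_sa IH -iterSr. Qed.

Lemma power_cone_psd T : power_cone C T -> psd T.
Proof.
elim=> [|k|S {}T _ [lS sS pS] _ [lT sT pT]|a S a0 _ [lS sS pS]].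
- split=> [a x y|x y|x]; first by rewrite scaler0 addr0.
    by rewrite inner0l inner0r.
  by rewrite inner0l.
- split=> [||x]; [exact: linear_iter|exact: iter_self_adjoint|].
  (* <C^(2j) x, x> = |C^j x|^2 and <C^(2j+1) x, x> = <C C^j x, C^j x>. *)
  rewrite -(odd_double_half k) -addnn addnCA !iterD iter_self_adjoint.
  by case: (odd k) => /=; [case: C_psd|exact: inner_ge0].
- split=> [a x y|x y|x]; first by rewrite lS lT scalerDr addrACA.
    by rewrite innerDl innerDr sS sT.
  by rewrite innerDl addr_ge0.
- split=> [b x y|x y|x]; first by rewrite lS scalerDr !scalerA mulrC.
    by rewrite innerZl innerZr sS conjC_ge0.
  by rewrite innerZl mulr_ge0.
Qed.

Lemma power_cone_linear T : power_cone C T -> linear T.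
Proof. by case/power_cone_psd. Qed.

Lemma power_cone_comp S T : power_cone C S -> power_cone C T ->
  power_cone C (S \o T).
Proof.
move=> + coneT; elim=> [|k|S1 S2 _ c1 _ c2|a S' a0 _ c].
- exact: power_cone0.
- elim: coneT => [|l|T1 T2 _ c1 _ c2|a T' a0 _ c].
  + rewrite (_ : _ \o _ = (fun=> 0)); first exact: power_cone0.
    by apply/funext => x /=; rewrite (linop0 (linear_iter k)).
  + rewrite (_ : _ \o _ = iter (k + l) C); first exact: power_coneX.
    by apply/funext => x /=; rewrite iterD.
  + rewrite (_ : _ \o _ =
      fun x => (iter k C \o T1) x + (iter k C \o T2) x).
      exact: power_coneD.
    by apply/funext => x /=; rewrite (linopD (linear_iter k)).
  + rewrite (_ : _ \o _ = fun x => a *: (iter k C \o T') x).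
      exact: power_coneZ.
    by apply/funext => x /=; rewrite (linopZ _ _ (linear_iter k)).
- exact: (power_coneD c1 c2).
- exact: (power_coneZ a0 c).
Qed.

Lemma power_cone_comm S T x : power_cone C S -> power_cone C T ->
  S (T x) = T (S x).
Proof.
move=> + coneT; elim=> [|k|S1 S2 _ c1 _ c2|a S' a0 _ c].
- by rewrite (linop0 (power_cone_linear coneT)).
- elim: coneT => [|l|T1 T2 _ c1 _ c2|a T' a0 _ c].
  + by rewrite (linop0 (linear_iter k)).
  + by rewrite -!iterD addnC.
  + by rewrite (linopD (linear_iter k)) c1 c2.
  + by rewrite (linopZ _ _ (linear_iter k)) c.
- by rewrite (linopD (power_cone_linear coneT)) c1 c2.
- by rewrite (linopZ _ _ (power_cone_linear coneT)) c.
Qed.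

End PowerCone.

End SquareRoot.

(** * Square roots of positive operators *)

Section SquareRoot.
Context {R : realType} {H : hilbertType R}.
Implicit Types (x y : H) (A C S T : H -> H).

(** If B is the limit, B = (C + B^2) / 2, that is (1 - B)^2 = 1 - C. *)
Fixpoint root_approx C n : H -> H :=
  if n is m.+1 then
    fun x => 2^-1 *: (C x + root_approx C m (root_approx C m x))
  else fun=> 0.

Section Limit.
Variable C : H -> H.
Hypothesis C_psd : psd C.
Hypothesis C_contr : forall x, `|C x| <= `|x|.

Local Notation B := (root_approx C).

Let half_ge0 : 0 <= 2^-1 :> R[i]. Proof. by rewrite invr_ge0 ler0n. Qed.

Lemma root_approx_cone n : power_cone C (B n).
Proof.
elim: n => [|n IH]; first exact: power_cone0.
apply: (power_coneZ half_ge0); apply: power_coneD.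
  exact: (power_coneX C 1).
exact: (power_cone_comp C_psd IH IH).
Qed.

Lemma root_approxS n x : B n.+1 x = 2^-1 *: (C x + B n (B n x)).
Proof. by []. Qed.

Lemma root_approx_linear n : linear (B n).
Proof. exact: (power_cone_linear C_psd (root_approx_cone n)). Qed.

(** The successive differences lie in the cone, hence are positive: this is
    the monotonicity of the sequence. *)
Lemma root_approx_step n : power_cone C (fun x => B n.+1 x - B n x).
Proof.
elim: n => [|n IH].
  rewrite (_ : (fun x => _) = fun x => 2^-1 *: C x).
    exact/(power_coneZ half_ge0)/(power_coneX C 1).
  by apply/funext => x /=; rewrite subr0 addr0.
(* B'^2 - B^2 = (B' - B)(B' + B), as B and B' commute. *)
rewrite (_ : (fun x => _) = fun x => 2^-1 *:
    ((fun y => B n.+1 y - B n y) \o (fun y => B n.+1 y + B n y)) x).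
  apply: (power_coneZ half_ge0); apply: power_cone_comp => //.
  by apply: power_coneD; exact: root_approx_cone.
apply/funext => x.
rewrite [B n.+2 x](root_approxS n.+1) [X in _ - X](root_approxS n) -scalerBr.
congr (_ *: _); rewrite compE.
rewrite !(linopD (root_approx_linear _)).
have -> := power_cone_comm C_psd x (root_approx_cone n) (root_approx_cone n.+1).
by rewrite opprD [LHS]addrACA subrr add0r opprD addrA addrK.
Qed.

Lemma root_approx_mono m n : (m <= n)%N ->
  power_cone C (fun x => B n x - B m x).
Proof.
move=> /subnK<-; elim: (n - m)%N => [|k IH].
  rewrite (_ : (fun x => _) = fun=> 0); first exact: power_cone0.
  by apply/funext => x; rewrite subrr.
rewrite (_ : (fun x => _) =
    fun x => (B (k + m).+1 x - B (k + m) x) + (B (k + m) x - B m x)).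
  by apply: power_coneD => //; exact: root_approx_step.
by apply/funext => x; rewrite addrA subrK.
Qed.

Lemma root_approx_contr n x : `|B n x| <= `|x|.
Proof.
elim: n x => [|n IH] x /=; first by rewrite normr0.
rewrite normrZ gtr0_norm ?invr_gt0 ?ltr0n// ler_pdivrMl ?ltr0n//.
rewrite mulr_natl mulr2n; apply: le_trans (ler_normD _ _) (lerD (C_contr _) _).
exact: le_trans (IH _) (IH _).
Qed.

Lemma root_approx_cvg x : cvgn (fun n => B n x).
Proof.
have Bpsd n : psd (B n) := power_cone_psd C_psd (root_approx_cone n).
have val_le n : '[B n x, x] <= '[x, x].
  have [_ _ pB] := Bpsd n.
  rewrite -[leLHS]ger0_norm//; apply: le_trans (cauchy_schwarz _ _) _.
  by rewrite innerxx expr2 ler_wpM2r// root_approx_contr.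
have real n : ((complex.Re (2 * '[B n x, x]))%:C = 2 * '[B n x, x])%C.
  have [_ _ pB] := Bpsd n.
  by rewrite RRe_real// ger0_real// mulr_ge0 ?ler0n.
apply: (@cvgn_le_gap _ _ _ (fun n => complex.Re (2 * '[B n x, x]))
  (complex.Re (2 * '[x, x]))) => [n|m n mn].
  rewrite -lecR real RRe_real ?ger0_real ?mulr_ge0 ?ler0n ?inner_ge0//.
  by rewrite ler_wpM2l ?ler0n.
(* The factor 2 bounds the norm of a difference of two contractions. *)
have dpsd := power_cone_psd C_psd (root_approx_mono mn).
rewrite rmorphB /= !real -mulrBr -innerBl -innerxx.
apply: (psd_sqnorm_le _ dpsd); rewrite ?ler0n// => y.
apply: le_trans (ler_normB _ _) _; rewrite mulr_natl mulr2n.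
by rewrite lerD ?root_approx_contr.
Qed.

(** The equation is the doubled fixed-point relation B = (C + B^2) / 2; passing
    to the limit in B_n (B_n x) uses that the B_n are contractions. *)
Lemma root_limit_exists : exists B0 : H -> H,
  [/\ linear B0, self_adjoint B0, forall x, `|B0 x| <= `|x| &
      forall x, B0 x + B0 x = C x + B0 (B0 x)].
Proof.
pose B0 x := lim (B n x @[n --> \oo]).
have BB0 x : B n x @[n --> \oo] --> B0 x by exact: root_approx_cvg.
have lB0 : linear B0.
  move=> a x y; have Baxy n : B n (a *: x + y) = a *: B n x + B n y.
    exact: root_approx_linear.
  apply: (cvg_unique (@norm_hausdorff _ _) (BB0 (a *: x + y))).
  rewrite /= (eq_cvg _ _ Baxy).
  by apply: cvgD => //; exact: cvgZr.
have B0_contr x : `|B0 x| <= `|x|.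
  apply/ler_addgt0Pr => e /(cvgn_dist (BB0 x))[N /(_ _ (leqnn N)) leN].
  rewrite -[B0 x](subrK (B N x)) addrC.
  apply: le_trans (ler_normD _ _) (lerD (root_approx_contr _ _) _).
  by rewrite distrC ltW.
exists B0; split=> // x.
  move=> y; have BC n : '[B n x, y] = '[x, B n y].
    by have [_ ->] := power_cone_psd C_psd (root_approx_cone n).
  exact: (cvgn_inner_eq (BB0 x) (BB0 y) BC).
have sq : B n (B n x) @[n --> \oo] --> B0 (B0 x).
  rewrite (_ : (fun n => _) = fun n => B n (B n x - B0 x) + B n (B0 x)).
    rewrite -[X in _ --> X]add0r; apply: cvgD => //.
    apply: cvgn_of_dist => e /(cvgn_dist (BB0 x))[N leN].
    exists N => n /leN; rewrite subr0; apply: le_lt_trans.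
    exact: root_approx_contr.
  by apply/funext => n; rewrite -(linopD (root_approx_linear n)) subrK.
suff {1 2}-> : B0 x = 2^-1 *: (C x + B0 (B0 x)).
  by rewrite -mulr2n -scaler_nat scalerA mulfV ?scale1r// pnatr_eq0.
have BS : B n.+1 x @[n --> \oo] --> B0 x.
  by rewrite (cvg_shiftS (B^~ x)); exact: BB0.
apply: (cvg_unique (@norm_hausdorff _ _) BS) => /=.
by apply: cvgZr; apply: cvgD; [exact: cvg_cst|exact: sq].
Qed.

End Limit.

(** If A has norm at most K, then C = 1 - A / K is a positive contraction, and
    sqrt K (1 - B) is a root of K (1 - C) = A. *)
Lemma positive_sqrt_exists A : positive_operator A ->
  exists S, positive_operator S /\ S \o S = A.
Proof.
move=> posA; have psdA := positive_psd posA.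
have [[lA [M boundA]] sA pA] := posA.
have [K K0 leK] : exists2 K : R[i], 0 < K & forall x, `|A x| <= K * `|x|.
  exists ((`|M| + 1)%:C)%C; first by rewrite ltcR ltr_wpDl.
  move=> x; apply: le_trans (boundA x) _; rewrite ler_wpM2r// lecR.
  by rewrite (le_trans (ler_norm M))// lerDl.
have KV0 : 0 <= K^-1 by rewrite invr_ge0 ltW.
have KC : K^-1^* = K^-1 by rewrite conjC_ge0.
have AAle x : '[A x, A x] <= K * '[A x, x].
  by apply: psd_sqnorm_le => //; exact: ltW.
have Ale x : '[A x, x] <= K * '[x, x].
  rewrite -[leLHS]ger0_norm//; apply: le_trans (cauchy_schwarz _ _) _.
  by rewrite innerxx expr2 mulrA ler_wpM2r.
pose C x := x - K^-1 *: A x.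
have Cpsd : psd C.
  split=> [a x y|x y|x].
  - rewrite /C lA scalerBr scalerDr !scalerA [K^-1 * a]mulrC opprD.
    by rewrite addrACA.
  - by rewrite /C innerBl innerBr innerZl innerZr sA KC.
  - by rewrite /C innerBl innerZl subr_ge0 ler_pdivrMl.
have Ccontr x : `|C x| <= `|x|.
  rewrite -(ler_pXn2r (isT : 0 < 2)%N) ?nnegrE// -!innerxx /C.
  rewrite innerBl !innerBr !innerZl !innerZr KC -sA.
  rewrite -subr_ge0.
  have -> : '[x, x] - ('[x, x] - K^-1 * '[A x, x] -
      (K^-1 * '[A x, x] - K^-1 * (K^-1 * '[A x, A x]))) =
      K^-1 * '[A x, x] + K^-1 * ('[A x, x] - K^-1 * '[A x, A x]) by ring.
  by rewrite addr_ge0 ?mulr_ge0// subr_ge0 ler_pdivrMl.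
have [B [lB sB Bcontr Beq]] := root_limit_exists Cpsd Ccontr.
pose k := sqrtC K; have k0 : 0 < k by rewrite sqrtC_gt0.
exists (fun x => k *: (x - B x)); split.
  split=> [|x y|x].
  - split=> [a x y|].
      rewrite lB !scalerBr !scalerDr opprD !scalerA [k * a]mulrC.
      by rewrite addrACA.
    have [d d0 kd] := gt0_complexP k0.
    exists (d * 2) => x; rewrite normrZ rmorphM /= -kd gtr0_norm// -mulrA.
    rewrite ler_wpM2l ?(ltW k0)//.
    apply: le_trans (ler_normB _ _) _.
    by rewrite rmorph_nat mulr_natl mulr2n lerD.
  - by rewrite innerZl innerZr innerBl innerBr sB conjC_ge0 // ltW.
  - rewrite innerZl mulr_ge0 ?(ltW k0)// innerBl subr_ge0.
    have realB : '[B x, x] \is Num.real.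
      by apply/CrealP; rewrite self_adjoint_real.
    apply: le_trans (real_ler_norm realB) (le_trans (cauchy_schwarz _ _) _).
    by rewrite innerxx expr2 ler_wpM2r.
apply/funext => x; rewrite /= (linopZ _ _ lB) (linopB _ _ lB) -scalerBr scalerA.
rewrite -expr2 sqrtCK.
have -> : x - B x - (B x - B (B x)) = x - (B x + B x) + B (B x).
  by rewrite opprB opprD !addrA addrAC.
rewrite Beq opprD addrA addrNK /C subKr.
by rewrite scalerA mulfV ?scale1r// gt_eqF.
Qed.

End SquareRoot.

(** * Parseval's identity *)

Section Bases.
Context {R : realType} {H : hilbertType R}.
Implicit Types (x y z e : H) (E : set H) (F G : {fset H}).

(** A nonzero vector orthogonal to E could be normalized and added to E. *)
Lemma basis_total E z : orthonormal_basis E ->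
  (forall e, E e -> '[z, e] = 0) -> z = 0.
Proof.
move=> [oE maxE] zE; apply: contrapT => /eqP z0.
pose w := `|z|^-1 *: z.
have Vz0 : 0 <= `|z|^-1 by rewrite invr_ge0.
have wE e : E e -> '[w, e] = 0 by move=> Ee; rewrite innerZl zE// mulr0.
have ww : '[w, w] = 1.
  rewrite innerZl innerZr (conjC_ge0 Vz0) innerxx expr2 mulKf ?mulVf//.
    by rewrite normr_eq0.
  by rewrite normr_eq0.
have wnE : ~ E w by move=> /wE/eqP; rewrite ww oner_eq0.
apply: wnE; rewrite -(maxE (E `|` [set w])); [by right| |by left].
move=> a b [Ea|->] [Eb|->]; rewrite ?ww ?eqxx//; first exact: oE.
  rewrite (innerC0 (wE _ Ea)); case: eqP => // aw.
  by have := wE _ Ea; rewrite aw ww => /eqP; rewrite oner_eq0.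
rewrite (wE _ Eb); case: eqP => // aw.
by have := wE _ Eb; rewrite -aw ww => /eqP; rewrite oner_eq0.
Qed.

Section Parseval.
Variables (E : set H) (x : H).
Hypothesis E_basis : orthonormal_basis E.

Let E_on : orthonormal_set E. Proof. by case: E_basis. Qed.

Definition inE_fset F := forall e, e \in F -> E e.

Definition fourier_weight e : R := complex.Re ('[x, e] * '[e, x]).

Definition fourier_mass F : R := \sum_(e <- F) fourier_weight e.

Definition fourier_sum F : H := \sum_(e <- F) '[x, e] *: e.

Lemma fourier_weightE e : ((fourier_weight e)%:C = '[x, e] * '[e, x])%C.
Proof.
by rewrite RRe_real// [X in _ * X]innerC -normCK ger0_real ?exprn_ge0.
Qed.

Lemma fourier_weight_ge0 e : 0 <= fourier_weight e.
Proof.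
by rewrite -ler0c fourier_weightE [X in _ * X]innerC -normCK exprn_ge0.
Qed.

Lemma inner_fourier_sumr F y :
  '[y, fourier_sum F] = \sum_(e <- F) '[e, x] * '[y, e].
Proof.
rewrite (big_morph (inner y) (innerDr y) (inner0r y)); apply: eq_bigr => e _.
by rewrite innerZr -innerC.
Qed.

Lemma inner_fourier_sum F e : inE_fset F -> E e ->
  '[fourier_sum F, e] = if e \in F then '[x, e] else 0.
Proof.
move=> FE Ee.
rewrite (big_morph (inner^~ e) (fun a b => innerDl a b e) (inner0l e)).
have term f : f \in F -> '['[x, f] *: f, e] = '[x, f] * (f == e)%:R.
  move=> /FE Ef; by rewrite innerZl [in LHS](E_on Ef Ee).
case: ifPn => eF.
  rewrite (big_fsetD1 e)//= (term _ eF) eqxx mulr1 big1_seq ?addr0// => f /=.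
  by rewrite in_fsetD1 => /andP[/negbTE fe fF]; rewrite term// fe mulr0.
rewrite big1_seq// => f /= fF; rewrite term//.
case: eqP => [fe|]; rewrite ?mulr0//.
by rewrite -fe fF in eF.
Qed.

Lemma fourier_massE F : ((fourier_mass F)%:C = '[x, fourier_sum F])%C.
Proof.
rewrite inner_fourier_sumr rmorph_sum; apply: eq_bigr => e _ /=.
by rewrite fourier_weightE mulrC.
Qed.

Lemma inner_fourier_sums F G : inE_fset G -> {subset F <= G} ->
  '[fourier_sum G, fourier_sum F] = ((fourier_mass F)%:C)%C.
Proof.
move=> GE FG; rewrite fourier_massE !inner_fourier_sumr !big_seq.
apply: eq_bigr => e eF; rewrite inner_fourier_sum ?FG//.
exact/GE/FG.
Qed.

Lemma fourier_sum_dist F G : inE_fset G -> {subset F <= G} ->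
  (`|fourier_sum G - fourier_sum F| ^+ 2
    = (fourier_mass G - fourier_mass F)%:C)%C.
Proof.
move=> GE FG; have FE : inE_fset F by move=> e /FG/GE.
rewrite -innerxx innerBl !innerBr inner_fourier_sums//.
rewrite (innerC (fourier_sum F)) !inner_fourier_sums// rmorphB /=.
by rewrite conjC_realC; ring.
Qed.

Lemma fourier_rest F : inE_fset F ->
  `|x - fourier_sum F| ^+ 2 = '[x, x] - ((fourier_mass F)%:C)%C.
Proof.
move=> FE; rewrite -innerxx innerBl !innerBr inner_fourier_sums//.
rewrite (innerC (fourier_sum F) x) -fourier_massE.
by rewrite conjC_realC subrr subr0.
Qed.

Lemma bessel F : inE_fset F -> fourier_mass F <= complex.Re '[x, x].
Proof.
move=> /fourier_rest FE; rewrite -lecR RRe_real ?ger0_real ?inner_ge0//.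
by rewrite -subr_ge0 -FE exprn_ge0.
Qed.

Lemma fourier_massU1 F e : e \notin F ->
  fourier_mass (e |` F)%fset = fourier_weight e + fourier_mass F.
Proof. by move=> eF; rewrite /fourier_mass big_fsetU1. Qed.

Lemma fourier_mass_mono F G : {subset F <= G} ->
  fourier_mass F <= fourier_mass G.
Proof.
move=> FG; rewrite /fourier_mass (big_fsetID _ (mem F) G) /=.
have -> : [fset y in G | y \in F]%fset = F.
  apply/fsetP => y; rewrite !inE /=; apply/andP/idP => [[]//|yF].
  by rewrite FG.
by rewrite lerDl sumr_ge0// => e _; exact: fourier_weight_ge0.
Qed.

(** Finite partial sums of nearly maximal mass form a Cauchy sequence. Its limit
    has the same Fourier coefficients as x, since a coefficient of x - sum_F x
    at e outside F is bounded by what adding e to F would gain. *)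
Lemma parseval_approx (d : R) : 0 < d ->
  exists2 F, inE_fset F & complex.Re '[x, x] < fourier_mass F + d.
Proof.
move=> d0.
pose masses := [set fourier_mass F | F in inE_fset].
have supM : has_sup masses.
  split; first by exists (fourier_mass fset0); exists fset0.
  by exists (complex.Re '[x, x]) => _ [F FE <-]; exact: bessel.
have massle F : inE_fset F -> fourier_mass F <= sup masses.
  by move=> FE; apply: ub_le_sup; [case: supM|exists F].
have nearsup n : exists F, inE_fset F /\
    sup masses - n.+1%:R^-1 < fourier_mass F.
  have n0 : 0 < n.+1%:R^-1 :> R by rewrite invr_gt0 ltr0n.
  by have [_ [F FE <-] ltF] := sup_adherent n0 supM; exists F.
have [F0 F0P] := choice nearsup.
pose G := fix G n := if n is m.+1 then (F0 n `|` G m)%fset else F0 0%N.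
have GE n : inE_fset (G n).
  elim: n => [|n IH] /=; first by case: (F0P 0%N).
  by move=> e; rewrite in_fsetU => /orP[/(proj1 (F0P _))|/IH].
have GS m n : (m <= n)%N -> {subset G m <= G n}.
  move=> /subnK<-; elim: (n - m)%N => // k IH e /IH.
  by rewrite addSn /= in_fsetU => ->; rewrite orbT.
have Gsup n : sup masses - n.+1%:R^-1 < fourier_mass (G n).
  apply: lt_le_trans (proj2 (F0P n)) (fourier_mass_mono _) => e eF.
  by case: n eF => //= n eF; rewrite in_fsetU eF.
have /(@cvgn_dist _ _ _ _) ul : cvgn (fun n => fourier_sum (G n)).
  apply: (@cvgn_le_gap _ _ _ (fun n => fourier_mass (G n))
    (complex.Re '[x, x])) => [n|m n mn]; first exact/bessel/GE.
  by rewrite fourier_sum_dist//; exact: GS.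
set l := lim _ in ul.
have small (e : R) : 0 < e -> exists N, forall n, (N <= n)%N ->
    sup masses - e < fourier_mass (G n).
  move=> /ltr_add_invr[N]; rewrite add0r => Ne.
  exists N => n Nn; apply: le_lt_trans (lt_le_trans (Gsup N) _).
    by rewrite lerD2l lerN2 ltW.
  exact/fourier_mass_mono/GS.
have coef n e : E e ->
    `|'[x - fourier_sum (G n), e]| ^+ 2
      <= ((sup masses - fourier_mass (G n))%:C)%C.
  move=> Ee; rewrite innerBl inner_fourier_sum//; case: ifPn => eG.
    by rewrite subrr normr0 expr0n ler0c subr_ge0 massle.
  rewrite subr0 normCK -innerC -fourier_weightE lecR lerBrDr.
  rewrite -fourier_massU1// massle// => f; rewrite in_fset1U.
  by move=> /orP[/eqP->//|/GE].
have xl : x = l.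
  apply/eqP; rewrite -subr_eq0; apply/eqP.
  apply: (basis_total E_basis) => e Ee.
  have e1 : `|e| = 1.
    have := E_on Ee Ee; rewrite innerxx eqxx => /eqP.
    by rewrite sqrf_eq1 => /orP[/eqP//|/eqP eN1]; have := normr_ge0 e;
      rewrite eN1 oppr_ge0 lt_geF ?ltr01.
  apply/eqP; rewrite -normr_le0; apply/ler_addgt0Pl => c c0; rewrite addr0.
  have [r r0 cr] := gt0_complexP c0.
  have r20 : 0 < r / 2 by rewrite divr_gt0.
  have [N1 leN1] := small _ (exprn_gt0 2 r20).
  have c20 : 0 < ((r / 2)%:C : R[i])%C by rewrite ltcR.
  have [N2 leN2] := ul _ c20.
  have := (leN1 _ (leq_maxl N1 N2), leN2 _ (leq_maxr N1 N2)).
  set n := maxn N1 N2 => -[le1 le2].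
  rewrite -[x - l](subrKA (fourier_sum (G n))) innerDl.
  rewrite cr [X in _ <= (X%:C)%C](splitr r) rmorphD /=.
  apply: le_trans (ler_normD _ _) (lerD _ _).
    rewrite -(ler_pXn2r (isT : 0 < 2)%N) ?nnegrE ?normr_ge0 ?(ltW c20)//.
    apply: le_trans (coef n e Ee) _; rewrite -rmorphXn /= lecR.
    by rewrite lerBlDr -lerBlDl ltW.
  by apply: le_trans (cauchy_schwarz _ _) _; rewrite e1 mulr1 ltW.
have [r r0 rd] : exists2 r : R, 0 < r & r ^+ 2 <= d.
  exists (Num.sqrt d); first by rewrite sqrtr_gt0.
  by rewrite sqr_sqrtr// ltW.
have c0 : 0 < (r%:C : R[i])%C by rewrite ltcR.
have [N /(_ N (leqnn N)) leN] := ul _ c0.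
exists (G N) => //; rewrite -ltrBlDl -ltcR rmorphB /=.
rewrite RRe_real ?ger0_real ?inner_ge0// -fourier_rest// {1}xl distrC.
apply: (@lt_le_trans _ _ ((r ^+ 2)%:C)%C); last by rewrite lecR.
by rewrite rmorphXn /= ltr_pXn2r// nnegrE// ltW.
Qed.

Lemma parseval :
  (\esum_(e in E) (fourier_weight e)%:E = (complex.Re '[x, x])%:E)%E.
Proof.
apply/eqP; rewrite eq_le; apply/andP; split.
  apply: ge_ereal_sup => _ [A [finA AE] <-].
  rewrite fsbig_finite// sumEFin lee_fin; apply: bessel => e.
  by rewrite in_fset_set// => /set_mem/AE.
apply/lee_addgt0Pr => d /parseval_approx[F FE lt_d].
apply: (@le_trans _ _ ((fourier_mass F)%:E + d%:E)%E).
  by rewrite -EFinD lee_fin ltW.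
rewrite leeD2r//; apply: esum_ge; exists [set` F].
  by split=> // e; exact: FE.
by rewrite fsbig_finite// set_fsetK sumEFin.
Qed.

End Parseval.
End Bases.

(** * Rank-one operators and the fidelity *)

Section RankOne.
Context {R : realType} {H : hilbertType R}.
Implicit Types (x y z : H) (c d : R[i]) (A B S T : H -> H).

Definition rank1 c x : H -> H := fun z => (c * '[z, x]) *: x.

Lemma bounded_comp A B :
  bounded_operator A -> bounded_operator B -> bounded_operator (A \o B).
Proof.
move=> [lA [M leM]] [lB [N leN]]; split; first exact: linop_comp.
exists (`|M| * `|N|) => x /=.
apply: le_trans (leM _) _; rewrite rmorphM /= -mulrA.
have abs_ge (r : R) : (r%:C <= `|r|%:C :> R[i])%C by rewrite lecR ler_norm.
apply: le_trans (ler_wpM2r _ (abs_ge M)) _ => //.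
rewrite ler_wpM2l// ?ler0c//; apply: le_trans (leN _) _.
exact: ler_wpM2r.
Qed.

Lemma rank1_positive c x : 0 <= c -> positive_operator (rank1 c x).
Proof.
move=> c0; split=> [|y z|y].
- split=> [a y z|].
    by rewrite /rank1 innerDl innerZl mulrDr scalerDl mulrCA scalerA.
  have k0 : 0 <= c * `|x| * `|x| by rewrite !mulr_ge0.
  exists (complex.Re (c * `|x| * `|x|)) => y.
  rewrite RRe_real ?ger0_real// normrZ normrM (ger0_norm c0).
  rewrite -!mulrA ler_wpM2l// [leLHS]mulrC ler_wpM2l// [leRHS]mulrC.
  exact: cauchy_schwarz.
- by rewrite /rank1 innerZl innerZr rmorphM /= conjC_ge0// -innerC mulrAC.
- by rewrite innerZl [X in _ * X]innerC -mulrA -normCK mulr_ge0 ?exprn_ge0.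
Qed.

(** Parseval's identity for the vector sqrt c x. *)
Lemma op_trace_rank1 c x : 0 <= c ->
  op_trace (rank1 c x) = (complex.Re (c * '[x, x]))%:E.
Proof.
move=> c0; have s0 : 0 <= sqrtC c by rewrite sqrtC_ge0.
have E_basis := xgetPex set0 (@orthonormal_basis_exists R H).
have -> : c * '[x, x] = '[sqrtC c *: x, sqrtC c *: x].
  by rewrite innerZl innerZr conjC_ge0// mulrA -expr2 sqrtCK.
rewrite -(parseval _ E_basis); apply: eq_esum => e _; congr (complex.Re _)%:E.
rewrite /rank1 !innerZl innerZr conjC_ge0// -{1}(sqrtCK c); ring.
Qed.

Lemma op_sqrtP A : positive_operator A ->
  positive_operator (op_sqrt A) /\ op_sqrt A \o op_sqrt A = A.
Proof. by move=> /positive_sqrt_exists; exact: xgetPex. Qed.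

(** By self-adjointness the range of T is orthogonal to its kernel, so it lies
    on the line of x. *)
Lemma rank1_of_ker T x : linear T -> self_adjoint T -> x != 0 ->
  (forall y, '[y, x] = 0 -> T y = 0) ->
  T = rank1 ('[T x, x] / '[x, x] ^+ 2) x.
Proof.
move=> lT sT x0 Tker; have n0 := inner_neq0 x0.
have perp z : '[z - ('[z, x] / '[x, x]) *: x, x] = 0.
  by rewrite innerBl innerZl divfK// subrr.
have Tz z : T z = ('[z, x] / '[x, x]) *: T x.
  by apply/eqP; rewrite -subr_eq0 -(linopZ _ _ lT) -(linopB _ _ lT) Tker.
have Tx : T x = ('[T x, x] / '[x, x]) *: x.
  apply/eqP; rewrite -subr_eq0; apply/eqP; apply: inner_eq0.
  rewrite {1}innerBl innerZl (innerC0 (perp _)) mulr0 subr0 sT Tker//.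
  by rewrite inner0r.
apply/funext => z; rewrite Tz {1}Tx scalerA /rank1; congr (_ *: _).
by field.
Qed.

(** The chosen square root S is identified here: from |S y|^2 = <S^2 y, y> it
    vanishes on the orthogonal complement of x, so it is a multiple of
    <., x> x, and S^2 determines the square of the factor. *)
Lemma op_sqrt_rank1 d x : 0 <= d ->
  op_sqrt (rank1 (d ^+ 2 * '[x, x]) x) = rank1 d x.
Proof.
move=> d0; have c0 : 0 <= d ^+ 2 * '[x, x].
  by rewrite mulr_ge0 ?exprn_ge0 ?inner_ge0.
have [/positive_psd psdS SS] := op_sqrtP (rank1_positive x c0).
set S := op_sqrt _ in psdS SS *; have [lS sS pS] := psdS.
have SSE z : S (S z) = rank1 (d ^+ 2 * '[x, x]) x z by rewrite -SS.
have Sker y : '[y, x] = 0 -> S y = 0.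
  move=> yx; apply: inner_eq0.
  by rewrite -sS SSE /rank1 yx mulr0 scale0r inner0l.
have [x0|x0] := eqVneq x 0.
  apply/funext => z; rewrite /rank1 x0 scaler0 Sker// x0 inner0r//.
have n0 := inner_neq0 x0.
have Sx := rank1_of_ker lS sS x0 Sker.
set k := _ / _ in Sx.
have k0 : 0 <= k by rewrite /k divr_ge0 ?exprn_ge0 ?inner_ge0.
rewrite Sx; congr rank1; apply/eqP.
rewrite -(eqrXn2 (isT : 0 < 2)%N)//.
have := congr1 (inner^~ x) (SSE x).
rewrite Sx /rank1 /= !innerZl => h.
apply/eqP; apply: (mulIf n0); apply: (mulIf n0); apply: (mulIf n0).
by transitivity (k * (k * '[x, x] * '[x, x]) * '[x, x]); [ring|rewrite h; ring].
Qed.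

Lemma comp_rank1 d x B : linear B -> 0 <= d ->
  rank1 d x \o B \o rank1 d x = rank1 (d ^+ 2 * '[B x, x]) x.
Proof.
move=> lB d0; apply/funext => z; rewrite /rank1 /= (linopZ _ _ lB) innerZl.
congr (_ *: _); ring.
Qed.

(** With n = <x, x>, the root of the first operator is n^(-1/2) <., x> x, so the
    middle operator is (<B x, x> / n) <., x> x; it is again of rank one, and its
    root has trace sqrt <B x, x>. *)
Lemma fidelity_rank1 x B : positive_operator B ->
  fidelity (rank1 1 x) B = (complex.Re (sqrtC '[B x, x]))%:E.
Proof.
move=> /positive_psd[lB _ pB]; rewrite /fidelity.
have [x0|x0] := eqVneq x 0.
  have r0 c c' : rank1 c x = rank1 c' x.
    by apply/funext => z; rewrite /rank1 x0 !scaler0.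
  rewrite (r0 1 (0 ^+ 2 * '[x, x])) op_sqrt_rank1// comp_rank1//.
  rewrite (r0 _ (0 ^+ 2 * '[x, x])) op_sqrt_rank1// op_trace_rank1//.
  by rewrite x0 !inner0r mulr0 sqrtC0.
have n0 := inner_neq0 x0; have nge0 := inner_ge0 x.
have d0 : 0 <= (sqrtC '[x, x])^-1 by rewrite invr_ge0 sqrtC_ge0.
have -> : rank1 1 x = rank1 ((sqrtC '[x, x])^-1 ^+ 2 * '[x, x]) x.
  by rewrite exprVn sqrtCK mulVf.
rewrite op_sqrt_rank1// comp_rank1//.
have t0 : 0 <= sqrtC '[B x, x] / '[x, x] by rewrite divr_ge0 ?sqrtC_ge0.
have -> : (sqrtC '[x, x])^-1 ^+ 2 * '[B x, x] =
    (sqrtC '[B x, x] / '[x, x]) ^+ 2 * '[x, x].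
  by rewrite exprVn sqrtCK expr_div_n sqrtCK; field.
by rewrite op_sqrt_rank1// op_trace_rank1// divfK.
Qed.

Lemma fidelity_rank1_inj x y A B : positive_operator A -> positive_operator B ->
  fidelity (rank1 1 x) A = fidelity (rank1 1 y) B -> '[A x, x] = '[B y, y].
Proof.
move=> posA posB; rewrite !fidelity_rank1// => -[].
have [_ _ pA] := positive_psd posA; have [_ _ pB] := positive_psd posB.
move=> /(congr1 (fun r => r%:C%C)).
rewrite !RRe_real ?ger0_real ?sqrtC_ge0// => /(congr1 (fun c => c ^+ 2)).
by rewrite !sqrtCK.
Qed.

(** All <T e, e> vanish, hence all T e, hence T x is orthogonal to the basis. *)
Lemma op_trace_eq0 T : positive_operator T -> op_trace T = 0%E -> T = fun=> 0.
Proof.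
move=> posT trT0; have psdT := positive_psd posT; have [lT sT pT] := psdT.
have E_basis := xgetPex set0 (@orthonormal_basis_exists R H).
apply/funext => x; apply: (basis_total E_basis) => e Ee.
rewrite sT (psd_eq0 psdT) ?inner0r//; apply/eqP.
have Te : complex.Re '[T e, e] = 0.
  apply/eqP; rewrite eq_le; apply/andP; split; last first.
    by rewrite -ler0c RRe_real ?ger0_real.
  rewrite -lee_fin -[leRHS]trT0; apply: esum_ge.
  by exists [set e]; [split=> // _ ->|rewrite fsbig_set1].
by rewrite -[_ e]RRe_real ?Te// ger0_real.
Qed.

(** With S a positive root of A, the fidelity vanishes when S B S = 0, and
    <S B S x, x> = <B S x, S x> = 0 means B S = 0. Conversely B A = 0 gives
    A B = 0 by taking adjoints, and |S B x|^2 = <A B x, B x>. *)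
Lemma fidelity_eq0 A B : positive_operator A -> positive_operator B ->
  fidelity A B = 0%E <-> forall x, B (A x) = 0.
Proof.
move=> posA posB; rewrite /fidelity.
have [posS SS] := op_sqrtP posA; set S := op_sqrt A in posS SS *.
have psdB := positive_psd posB; have [lB sB pB] := psdB.
have [lS sS pS] := positive_psd posS.
have posSBS : positive_operator (S \o B \o S).
  split=> [|x y|x]; last by rewrite /= sS.
    have [bS _ _] := posS; have [bB _ _] := posB.
    exact/bounded_comp/bS/bounded_comp.
  by rewrite /= sS sB sS.
have [posT TT] := op_sqrtP posSBS; set T := op_sqrt _ in posT TT *.
have [lT sT _] := positive_psd posT.
have AE x : A x = S (S x) by rewrite -SS.
have TTE x : T (T x) = S (B (S x)) := congr1 (@^~ x) TT.
split=> [/(op_trace_eq0 posT) T0 x|BA0].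
  rewrite AE; apply: (psd_eq0 psdB).
  by rewrite -sS -TTE T0 inner0l.
have AB0 x : A (B x) = 0.
  by apply: inner_eq0; rewrite AE sS sS -AE sB BA0 inner0r.
have SB0 x : S (B x) = 0.
  by apply: inner_eq0; rewrite -sS -AE AB0 inner0l.
have T0 x : T x = 0 by apply: inner_eq0; rewrite -sT TTE SB0 inner0l.
by rewrite /op_trace esum1// => e _; rewrite T0 inner0l.
Qed.

End RankOne.

(** * Wigner's theorem *)

Section Wigner.
Context {R : realType} {H : hilbertType R}.
Implicit Types (x y z u v w : H) (a c p : R[i]).

Definition same_ray u v := exists2 p : R[i], `|p| = 1 & u = p *: v.

Lemma same_ray_sym u v : same_ray u v -> same_ray v u.
Proof.
move=> [p p1 ->]; have p0 : p != 0 by rewrite -normr_eq0 p1 oner_eq0.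
by exists p^-1; rewrite ?normfV ?p1 ?invr1// scalerA mulVf// scale1r.
Qed.

Lemma same_ray_trans u v w : same_ray u v -> same_ray v w -> same_ray u w.
Proof.
move=> [p p1 ->] [q q1 ->]; exists (p * q); first by rewrite normrM p1 q1 mulr1.
by rewrite scalerA.
Qed.

Lemma same_rayZ a u v : same_ray u v -> same_ray (a *: u) (a *: v).
Proof. by move=> [p p1 ->]; exists p => //; rewrite !scalerA mulrC. Qed.

Lemma same_ray_inner u u' v v' : same_ray u u' -> same_ray v v' ->
  `|'[u, v]| = `|'[u', v']|.
Proof.
move=> [p p1 ->] [q q1 ->].
by rewrite innerZl innerZr !normrM norm_conjC p1 q1 !mul1r.
Qed.

Lemma norm1_conj p : `|p| = 1 -> p * p^* = 1.
Proof. by move=> p1; rewrite -normCK p1 expr1n. Qed.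

(** |1 + z|^2 = 1 + |z|^2 + 2 Re z. *)
Lemma eq_re_of_norm (z w : R[i]) : `|z| = `|w| -> `|1 + z| = `|1 + w| ->
  z + z^* = w + w^*.
Proof.
move=> zw /(congr1 (fun c => c ^+ 2)); rewrite !normCK !rmorphD /= !conjC1.
have := congr1 (fun c => c ^+ 2) zw; rewrite /= !normCK => zzww.
have E (c d : R[i]) : (1 + c) * (1 + d) = 1 + c * d + (c + d) by ring.
by rewrite !E zzww => /addrI.
Qed.

(** The linear and conjugate-linear cases are treated together: b tells which
    automorphism of the scalars the map follows. *)
Definition conj_if (b : bool) a : R[i] := if b then a^* else a.

Section ConjIf.
Variable b : bool.
Local Notation sg := (conj_if b).

Lemma conj_ifD a c : sg (a + c) = sg a + sg c.
Proof. by case: b; rewrite //= rmorphD. Qed.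

Lemma conj_ifM a c : sg (a * c) = sg a * sg c.
Proof. by case: b; rewrite //= rmorphM. Qed.

Lemma conj_ifC a : sg (a^*) = (sg a)^*.
Proof. by case: b. Qed.

Lemma conj_ifK a : sg (sg a) = a.
Proof. by case: b; rewrite //= conjCK. Qed.

Lemma conj_if_norm a : `|sg a| = `|a|.
Proof. by case: b; rewrite //= norm_conjC. Qed.

Lemma conj_if0 : sg 0 = 0.
Proof. by case: b; rewrite //= conjC0. Qed.

Lemma conj_if1 : sg 1 = 1.
Proof. by case: b; rewrite //= conjC1. Qed.

Lemma conj_ifi : sg 'i = if b then - 'i else 'i.
Proof. by case: b; rewrite //= conjCi. Qed.

End ConjIf.

Section RayMap.
Variable f : H -> H.
Hypothesis f_inner : forall x y, `|'[f x, f y]| = `|'[x, y]|.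

Lemma ray_map_sqnorm x : '[f x, f x] = '[x, x].
Proof. by have := f_inner x x; rewrite !ger0_norm ?inner_ge0. Qed.

Lemma ray_map0 : f 0 = 0.
Proof. by apply: inner_eq0; rewrite ray_map_sqnorm inner0l. Qed.

Lemma ray_map_orth x y : '[x, y] = 0 -> '[f x, f y] = 0.
Proof.
by move=> xy; apply/eqP; rewrite -normr_eq0 f_inner xy normr0.
Qed.

(** Equality in Cauchy-Schwarz for f (a x) and f x makes them proportional.
    Leaving the factor c free up to a phase lets a be conjugated. *)
Lemma ray_map_scale a c x : `|c| = `|a| -> same_ray (f (a *: x)) (c *: f x).
Proof.
move=> ca; have [->|x0] := eqVneq x 0.
  by exists 1; rewrite ?normr1// scaler0 ray_map0 !scaler0.
have [a0|a0] := eqVneq a 0.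
  have -> : c = 0 by apply/eqP; rewrite -normr_eq0 ca a0 normr0.
  by exists 1; rewrite ?normr1// a0 !scale0r ray_map0 scaler0.
have c0 : c != 0 by rewrite -normr_eq0 ca normr_eq0.
have n0 := inner_neq0 x0.
pose d := '[f (a *: x), f x] / '[x, x].
have dE : '[f (a *: x), f x] = d * '[x, x] by rewrite divfK.
have da : `|d| = `|a|.
  by rewrite normrM f_inner innerZl normrM normfV mulfK// normr_eq0.
have dC : '[f x, f (a *: x)] = d^* * '[x, x].
  by rewrite innerC dE rmorphM /= innerxxC.
have fax : f (a *: x) = d *: f x.
  apply/eqP; rewrite -subr_eq0; apply/eqP; apply: inner_eq0.
  rewrite innerBl !innerBr !(innerZl, innerZr) dE dC !ray_map_sqnorm.
  rewrite innerZl innerZr; have da2 : a * a^* = d * d^* by rewrite -!normCK da.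
  by rewrite mulrA da2; ring.
exists (d / c); first by rewrite normrM normfV da ca mulfV// normr_eq0.
by rewrite fax scalerA divfK.
Qed.

Variable e : H.
Hypothesis e1 : '[e, e] = 1.

(** f (e + x) has components of modulus 1 along f e and |x| along f x, which
    exhaust its squared norm 1 + |x|^2. So it is a f e + c f x with a and c
    phases, and u = (c / a) f x. *)
Lemma ray_map_sum x : '[x, e] = 0 ->
  exists u, same_ray u (f x) /\ same_ray (f (e + x)) (f e + u).
Proof.
move=> xe; have ex := innerC0 xe.
have [->|x0] := eqVneq x 0.
  exists 0; split; exists 1; rewrite ?normr1//.
    by rewrite ray_map0 scaler0.
  by rewrite !addr0 scale1r.
have n0 := inner_neq0 x0; set w := f (e + x).
pose a := '[w, f e]; pose c := '[w, f x] / '[x, x].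
have a1 : `|a| = 1 by rewrite /a f_inner innerDl e1 xe addr0 normr1.
have wfx : '[w, f x] = c * '[x, x] by rewrite /c divfK.
have c1 : `|c| = 1.
  by rewrite /c normrM f_inner innerDl ex add0r -normrM divff// normr1.
have a0 : a != 0 by rewrite -normr_eq0 a1 oner_eq0.
have fex := ray_map_orth ex; have fxe := ray_map_orth xe.
have fe1 : '[f e, f e] = 1 by rewrite ray_map_sqnorm.
have fxw : '[f x, w] = c^* * '[x, x] by rewrite innerC wfx rmorphM /= innerxxC.
have ww : '[w, w] = 1 + '[x, x].
  by rewrite ray_map_sqnorm add_orthogonal_sqnorm// e1.
have wE : w = a *: f e + c *: f x.
  apply/eqP; rewrite -subr_eq0; apply/eqP; apply: inner_eq0.
  rewrite !(innerBl, innerBr) !(innerDl, innerDr) !(innerZl, innerZr).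
  rewrite fex fxe fe1 (innerC (f e) w) -/a wfx fxw ww ray_map_sqnorm.
  transitivity (1 - a * a^* + (1 - c * c^*) * '[x, x]); first by ring.
  by rewrite !norm1_conj// !subrr mul0r addr0.
exists ((a^-1 * c) *: f x); split.
  by exists (a^-1 * c) => //; rewrite normrM normfV a1 c1 invr1 mulr1.
by exists a => //; rewrite scalerDr scalerA mulVKf.
Qed.

Section PerpMap.
Variable U : H -> H.
Hypothesis U_ray : forall x, '[x, e] = 0 -> same_ray (U x) (f x).
Hypothesis U_sum : forall x, '[x, e] = 0 -> same_ray (f (e + x)) (f e + U x).

Lemma perp_map_orth x : '[x, e] = 0 -> '[f e, U x] = 0.
Proof.
move=> xe; have [p _ ->] := U_ray xe.
by rewrite innerZr (ray_map_orth (innerC0 xe)) mulr0.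
Qed.

(** U preserves |<x, y>|, and |1 + <x, y>| because f (e + x) is proportional to
    f e + U x. *)
Lemma perp_map_re x y : '[x, e] = 0 -> '[y, e] = 0 ->
  '[U x, U y] + '[U y, U x] = '[x, y] + '[y, x].
Proof.
move=> xe ye; rewrite (innerC (U y)) (innerC y); apply: eq_re_of_norm.
  by rewrite (same_ray_inner (U_ray xe) (U_ray ye)) f_inner.
have := f_inner (e + x) (e + y).
rewrite (same_ray_inner (U_sum xe) (U_sum ye)) !innerDl !innerDr.
rewrite ray_map_sqnorm e1 xe (innerC0 ye) (perp_map_orth ye).
by rewrite (innerC0 (perp_map_orth xe)) !addr0 !add0r.
Qed.

Lemma perp_map_sqnorm x : '[x, e] = 0 -> '[U x, U x] = '[x, x].
Proof.
move=> xe; have := same_ray_inner (U_ray xe) (U_ray xe).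
by rewrite f_inner !ger0_norm ?inner_ge0.
Qed.

Lemma perpD x y : '[x, e] = 0 -> '[y, e] = 0 -> '[x + y, e] = 0.
Proof. by move=> xe ye; rewrite innerDl xe ye addr0. Qed.

Lemma perpZ a x : '[x, e] = 0 -> '[a *: x, e] = 0.
Proof. by move=> xe; rewrite innerZl xe mulr0. Qed.

(** |U (x + y) - U x - U y|^2 involves only real parts of inner products, so it
    equals |(x + y) - x - y|^2. *)
Lemma perp_mapD x y : '[x, e] = 0 -> '[y, e] = 0 -> U (x + y) = U x + U y.
Proof.
move=> xe ye; have xye := perpD xe ye.
apply/eqP; rewrite -subr_eq0 opprD addrA; apply/eqP; apply: inner_eq0.
have E u v w : '[u - v - w, u - v - w] = '[u, u] + '[v, v] + '[w, w]
    - ('[u, v] + '[v, u]) - ('[u, w] + '[w, u]) + ('[v, w] + '[w, v]).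
  by rewrite !(innerBl, innerBr); ring.
rewrite E !perp_map_re// !perp_map_sqnorm// -E.
by rewrite [x + y]addrC addrK subrr inner0l.
Qed.

Lemma perp_map_real (r : R[i]) x : '[x, e] = 0 -> r^* = r ->
  U (r *: x) = r *: U x.
Proof.
move=> xe rC; have rxe := perpZ r xe.
apply/eqP; rewrite -subr_eq0; apply/eqP; apply: inner_eq0.
have E u v : '[u - r *: v, u - r *: v] =
    '[u, u] - r * ('[u, v] + '[v, u]) + r ^+ 2 * '[v, v].
  by rewrite innerBl !innerBr !(innerZl, innerZr) rC; ring.
by rewrite E !perp_map_re// !perp_map_sqnorm// -E subrr inner0l.
Qed.

(** w = <U (i x), U x> has zero real part and modulus |x|^2, so it is
    +- i |x|^2, which is equality in Cauchy-Schwarz. *)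
Lemma perp_map_i x : '[x, e] = 0 ->
  U ('i *: x) = 'i *: U x \/ U ('i *: x) = - 'i *: U x.
Proof.
move=> xe; have ixe := perpZ 'i xe.
set w := '[U ('i *: x), U x].
have w2 : w ^+ 2 = ('i * '[x, x]) ^+ 2.
  have wC : w^* = - w.
    apply/eqP; rewrite -addr_eq0 addrC /w -innerC perp_map_re//.
    by rewrite innerZl innerZr conjCi mulNr subrr.
  have : `|w| = '[x, x].
    rewrite (same_ray_inner (U_ray ixe) (U_ray xe)) f_inner innerZl normrM.
    by rewrite normCi mul1r ger0_norm ?inner_ge0.
  move/(congr1 (fun c => c ^+ 2)); rewrite normCK wC mulrN exprMn sqrCi => <-.
  by rewrite expr2; ring.
have go (k : R[i]) : k * k^* = 1 -> w = k * '[x, x] -> U ('i *: x) = k *: U x.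
  move=> k1 wk; apply/eqP; rewrite -subr_eq0; apply/eqP; apply: inner_eq0.
  have wkC : '[U x, U ('i *: x)] = k^* * '[x, x].
    by rewrite innerC -/w wk rmorphM /= innerxxC.
  rewrite innerBl !innerBr !(innerZl, innerZr) -/w wkC wk !perp_map_sqnorm//.
  rewrite innerZl innerZr conjCi.
  transitivity ('[x, x] * (- 'i ^+ 2 - k * k^*)); first by ring.
  by rewrite sqrCi opprK k1 subrr mulr0.
have ii : 'i * 'i^* = 1 :> R[i] by rewrite conjCi mulrN -expr2 sqrCi opprK.
move/eqP: w2; rewrite eqf_sqr => /orP[/eqP wi|/eqP wi].
  by left; apply: go.
by right; apply: go; [rewrite rmorphN mulrNN|rewrite wi mulNr].
Qed.

(** If U (i x) = i U x and U (i y) = - i U y, additivity gives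
    i U x - i U y = +-(i U x + i U y), so U x or U y vanishes. *)
Lemma perp_map_i_uniform : exists b, forall x, '[x, e] = 0 ->
  U ('i *: x) = conj_if b 'i *: U x.
Proof.
have [allI|] := pselect (forall x, '[x, e] = 0 -> U ('i *: x) = 'i *: U x).
  by exists false.
move=> /existsNP[x /not_implyP[xe Ux]]; exists true => y ye; rewrite conj_ifi.
have Uxm : U ('i *: x) = - 'i *: U x by have [/Ux|] := perp_map_i xe.
have [Uyp|//] := perp_map_i ye.
have i0 : 'i != 0 :> R[i] by rewrite neq0Ci.
have halve u : u = - u -> u = 0 :> H.
  move=> /eqP; rewrite -addr_eq0 -mulr2n -scaler_nat scaler_eq0 pnatr_eq0 /=.
  by move/eqP.
have Ux0 : U x != 0.
  by apply/eqP => Ux0; apply: Ux; rewrite Uxm Ux0 !scaler0.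
have Dxy : U ('i *: (x + y)) = - 'i *: U x + 'i *: U y.
  by rewrite scalerDr perp_mapD ?perpZ// Uxm Uyp.
have := perp_map_i (perpD xe ye); rewrite Dxy (perp_mapD xe ye) !scalerDr.
case=> [/addIr|/addrI] E.
  move: E; rewrite scaleNr => /esym/halve/eqP.
  by rewrite scaler_eq0 (negbTE i0) (negbTE Ux0).
by rewrite Uyp.
Qed.

Lemma perp_map_semilinear : exists b,
  (forall a x, '[x, e] = 0 -> U (a *: x) = conj_if b a *: U x) /\
  (forall x y, '[x, e] = 0 -> '[y, e] = 0 -> '[U x, U y] = conj_if b '[x, y]).
Proof.
have [b Ui] := perp_map_i_uniform; exists b; split=> [a x xe|x y xe ye].
  have realC (r : R[i]) : r \is Num.real -> conj_if b r = r.
    by move=> /conj_Creal rC; rewrite /conj_if rC if_same.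
  have realU (r : R[i]) z : r \is Num.real -> '[z, e] = 0 ->
      U (r *: z) = r *: U z.
    by move=> /conj_Creal rC ze; exact: perp_map_real.
  rewrite [a]Crect conj_ifD conj_ifM.
  rewrite (realC ('Re a)) ?(realC ('Im a)) ?Creal_Re ?Creal_Im//.
  rewrite scalerDl perp_mapD ?perpZ// realU ?Creal_Re// scalerDl.
  have -> : ('i * 'Im a) *: x = 'Im a *: ('i *: x) by rewrite scalerA mulrC.
  by rewrite realU ?perpZ ?Creal_Im// Ui// scalerA ['Im a * _]mulrC.
have := perp_map_re (perpZ 'i xe) ye; have := perp_map_re xe ye.
rewrite Ui// !(innerZl, innerZr) (innerC (U y)) (innerC y).
set h := '[U x, U y]; set z := '[x, y].
rewrite conjCi => re im; apply: (mulfI (x := 2)); first by rewrite pnatr_eq0.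
have i0 : 'i != 0 :> R[i] by rewrite neq0Ci.
move: im; rewrite conj_ifi /conj_if; case: b {Ui} => im.
  have {}im : h - h^* = z^* - z.
    apply: (mulfI i0); move: im; rewrite rmorphN /= conjCi => im.
    transitivity (- (- 'i * h + - - 'i * h^*)); first by ring.
    by rewrite im; ring.
  transitivity ((h + h^*) + (h - h^*)); first by ring.
  by rewrite re im; ring.
have {}im : h - h^* = z - z^*.
  apply: (mulfI i0); move: im; rewrite conjCi => im.
  transitivity ('i * h + - 'i * h^*); first by ring.
  by rewrite im; ring.
transitivity ((h + h^*) + (h - h^*)); first by ring.
by rewrite re im; ring.
Qed.

End PerpMap.

Lemma wigner_isometry : exists b V, [/\
  forall a x y, V (a *: x + y) = conj_if b a *: V x + V y,
  forall x y, '[V x, V y] = conj_if b '[x, y] &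
  forall x, same_ray (f x) (V x)].
Proof.
have /choice[U UP] x : exists u, '[x, e] = 0 ->
    same_ray u (f x) /\ same_ray (f (e + x)) (f e + u).
  have [xe|xe] := pselect ('[x, e] = 0); last by exists 0 => /xe.
  by have [u uP] := ray_map_sum xe; exists u.
have U_ray x (xe : '[x, e] = 0) := proj1 (UP x xe).
have U_sum x (xe : '[x, e] = 0) := proj2 (UP x xe).
have [b [UZ Uinner]] := perp_map_semilinear U_ray U_sum.
have UD := perp_mapD U_ray U_sum.
pose P z := z - '[z, e] *: e.
have Pe z : '[P z, e] = 0 by rewrite innerBl innerZl e1 mulr1 subrr.
have zP z : z = '[z, e] *: e + P z by rewrite addrC subrK.
have PD a x y : P (a *: x + y) = a *: P x + P y.
  by rewrite /P innerDl innerZl scalerBr scalerA scalerDl opprD addrACA.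
have P_id z : '[z, e] = 0 -> P z = z by move=> ze; rewrite /P ze scale0r subr0.
clearbody P; pose V z := conj_if b '[z, e] *: f e + U (P z).
exists b, V; split=> [a x y|x y|z].
- rewrite /V PD innerDl innerZl.
  rewrite conj_ifD conj_ifM UD ?perpZ// UZ// scalerDl scalerDr scalerA.
  by rewrite addrACA.
- have fU := perp_map_orth U_ray.
  rewrite [in RHS](zP x) [in RHS](zP y) /V !(innerDl, innerDr).
  rewrite !(innerZl, innerZr) ray_map_sqnorm e1 !Pe (innerC0 (Pe _)) !fU//.
  rewrite (innerC0 (fU _ _))// Uinner// !conj_ifD !conj_ifM conj_if1 conj_if0.
  by rewrite conj_ifC; ring.
have [l0|l0] := eqVneq '[z, e] 0.
  apply: same_ray_sym; rewrite /V l0 conj_if0 scale0r add0r.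
  by rewrite P_id//; exact: U_ray.
have zE : z = '[z, e] *: (e + '[z, e]^-1 *: P z).
  by rewrite scalerDr scalerA mulfV// scale1r -zP.
have ue := perpZ '[z, e]^-1 (Pe z).
have -> : V z = conj_if b '[z, e] *: (f e + U ('[z, e]^-1 *: P z)).
  by rewrite scalerDr -UZ// scalerA mulfV// scale1r.
rewrite {1}zE; apply: same_ray_trans (same_rayZ _ (U_sum _ ue)).
by apply: ray_map_scale; rewrite conj_if_norm.
Qed.

End RayMap.

(** Surjectivity of f up to phases makes the isometry V onto, hence
    invertible. A unit vector exists unless the space is zero, where the
    identity works. *)
Theorem wigner (f : H -> H) :
  (forall x y, `|'[f x, f y]| = `|'[x, y]|) ->
  (forall y, exists x, same_ray y (f x)) ->
  exists V Vinv, [/\ unitary V \/ antiunitary V, cancel V Vinv,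
    cancel Vinv V & forall x, same_ray (f x) (V x)].
Proof.
move=> f_inner f_onto.
have [H0|/existsNP[v /eqP v0]] := pselect (forall x : H, x = 0).
  exists id, id; split=> //; first by left; split=> //; exists id.
  by move=> x; exists 1; rewrite ?normr1// scale1r [LHS]H0 [RHS]H0.
pose e := `|v|^-1 *: v.
have nv0 : `|v| != 0 by rewrite normr_eq0.
have e1 : '[e, e] = 1.
  rewrite innerZl innerZr innerxx conjC_ge0 ?invr_ge0//.
  by rewrite expr2 mulKf// mulVf.
have [b [V [Vlin Vinner fV]]] := wigner_isometry f_inner e1.
have V0 : V 0 = 0.
  by apply: inner_eq0; rewrite Vinner inner0l conj_if0.
have VZ a x : V (a *: x) = conj_if b a *: V x.
  by rewrite -[a *: x]addr0 Vlin V0 addr0.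
have Vonto y : exists x, V x = y.
  have [x [p _ ->]] := f_onto y; have [q _ ->] := fV x.
  by exists (conj_if b (p * q) *: x); rewrite VZ conj_ifK scalerA.
have [Vinv VinvK] := choice Vonto.
have VK : cancel V Vinv.
  move=> x; apply/eqP; rewrite -subr_eq0; apply/eqP; apply: inner_eq0.
  rewrite -[LHS](conj_ifK b) -Vinner addrC -scaleN1r Vlin VinvK.
  have -> : conj_if b (-1) = -1 by case: (b); rewrite //= rmorphN /= conjC1.
  by rewrite scaleN1r addNr inner0l conj_if0.
exists V, Vinv; split=> //.
have bij : bijective V by exists Vinv.
move: Vlin Vinner; rewrite /conj_if.
case: (b) => Vlin Vinner; [right|left]; split=> //.
by move=> x y; rewrite Vinner -innerC.
Qed.

End Wigner.

(** * States and orthogonality *)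

Section DensityOperators.
Context {R : realType} {H : hilbertType R}.
Implicit Types (A B C : density_operators H) (x y z : H).

Lemma density_positive A : positive_operator (val A).
Proof. by have [] := set_mem (valP A). Qed.

Lemma rank1_density x : density_operators H (rank1 1 x).
Proof.
split; first exact: rank1_positive.
by rewrite op_trace_rank1 ?ltry.
Qed.

Definition ketbra x : density_operators H :=
  exist _ (rank1 1 x) (mem_set (rank1_density x)).

Lemma inner_ketbra x z : '[val (ketbra x) z, z] = `|'[z, x]| ^+ 2.
Proof. by rewrite /= /rank1 mul1r innerZl normCK -innerC. Qed.

Definition orthogonal_states A B := fidelity (val A) (val B) = 0%E.

Lemma orthogonal_statesP A B :
  orthogonal_states A B <-> forall x, val B (val A x) = 0.
Proof. exact: fidelity_eq0 (density_positive A) (density_positive B). Qed.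

Lemma orthogonal_statesC A B : orthogonal_states A B -> orthogonal_states B A.
Proof.
move=> /orthogonal_statesP AB; apply/orthogonal_statesP => x.
have [_ sA _] := density_positive A; have [_ sB _] := density_positive B.
by apply: inner_eq0; rewrite sA sB AB inner0r.
Qed.

(** The nonzero states whose support has no nonzero proper subspace supporting
    a state, expressed by orthogonality alone. *)
Definition minimal_state A :=
  (exists B, ~ orthogonal_states A B) /\
  forall C, (exists B, ~ orthogonal_states C B) ->
    (forall B, orthogonal_states A B -> orthogonal_states C B) ->
    forall B, orthogonal_states C B -> orthogonal_states A B.

Lemma orthogonal_all A : (forall B, orthogonal_states A B) -> val A = fun=> 0.
Proof.
move=> /(_ A)/orthogonal_statesP AA; apply/funext => x.
have [_ sA _] := density_positive A.
by apply: inner_eq0; rewrite sA AA inner0r.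
Qed.

Lemma orthogonal_ketbra x A : orthogonal_states (ketbra x) A <-> val A x = 0.
Proof.
have /positive_psd[lA _ _] := density_positive A.
split=> [/orthogonal_statesP/(_ x)|Ax0]; last first.
  by apply/orthogonal_statesP => z; rewrite /= (linopZ _ _ lA) Ax0 scaler0.
have [->|x0] := eqVneq x 0; first by rewrite (linop0 lA).
rewrite /= /rank1 mul1r (linopZ _ _ lA) => /eqP.
by rewrite scaler_eq0 (negbTE (inner_neq0 x0)) => /eqP.
Qed.

Lemma rank1_scale (c : R[i]) x : 0 <= c -> rank1 c x = rank1 1 (sqrtC c *: x).
Proof.
move=> c0; apply/funext => z.
rewrite /rank1 innerZr conjC_ge0 ?sqrtC_ge0// scalerA -{1}(sqrtCK c).
congr (_ *: _); ring.
Qed.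

(** If C is orthogonal to every state orthogonal to |x><x|, in particular to
    |y><y| for y orthogonal to x, then C is a nonzero multiple of |x><x|. *)
Lemma minimal_ketbra x : x != 0 -> minimal_state (ketbra x).
Proof.
move=> x0; have n0 := inner_neq0 x0.
split.
  exists (ketbra x) => /orthogonal_ketbra /eqP.
  by rewrite /= /rank1 mul1r scaler_eq0 (negbTE n0) (negbTE x0).
move=> C [B0 CB0] sub B CB.
have psdC := positive_psd (density_positive C); have [lC sC _] := psdC.
have Cker y : '[y, x] = 0 -> val C y = 0.
  move=> yx; apply/orthogonal_ketbra/orthogonal_statesC/sub.
  by apply/orthogonal_ketbra; rewrite /= /rank1 (innerC0 yx) mulr0 scale0r.
have CE := rank1_of_ker lC sC x0 Cker.
set c := _ / _ in CE.
have c0 : c != 0.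
  apply/eqP => c0; apply: CB0; apply/orthogonal_statesP => z.
  have /positive_psd[lB _ _] := density_positive B0.
  by rewrite CE c0 /rank1 mul0r scale0r (linop0 lB).
have /positive_psd[lB _ _] := density_positive B.
apply/orthogonal_ketbra; move/orthogonal_statesP: CB => /(_ x).
rewrite CE /rank1 (linopZ _ _ lB) => /eqP.
by rewrite scaler_eq0 mulf_eq0 (negbTE c0) (negbTE n0) => /eqP.
Qed.

(** For a nonzero x in the range of A, minimality applies to C = |x><x|, since
    B A = 0 implies B x = 0. So A is orthogonal to |y><y|, that is A y = 0, for
    every y orthogonal to x. *)
Lemma minimal_rank1 A : minimal_state A -> exists x, A = ketbra x.
Proof.
move=> [[B0 AB0] minA].
have [x Ax x0] : exists2 x, exists u, x = val A u & x != 0.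
  apply: contrapT => A0; apply: AB0; apply/orthogonal_statesP => u.
  have /positive_psd[lB _ _] := density_positive B0.
  have [->|Au0] := eqVneq (val A u) 0; first by rewrite (linop0 lB).
  by case: A0; exists (val A u) => //; exists u.
have [u xu] := Ax.
have psdA := positive_psd (density_positive A); have [lA sA pA] := psdA.
have Aker y : '[y, x] = 0 -> val A y = 0.
  move=> yx; apply/orthogonal_ketbra/orthogonal_statesC.
  apply: (minA (ketbra x)); last first.
  - by apply/orthogonal_ketbra; rewrite /= /rank1 (innerC0 yx) mulr0 scale0r.
  - move=> B /orthogonal_statesP AB.
    by apply/orthogonal_ketbra; rewrite xu.
  - by have [] := minimal_ketbra x0.
have c0 : 0 <= '[val A x, x] / '[x, x] ^+ 2.
  by rewrite divr_ge0 ?exprn_ge0 ?inner_ge0.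
exists (sqrtC ('[val A x, x] / '[x, x] ^+ 2) *: x); apply: val_inj.
by rewrite [LHS](rank1_of_ker lA sA x0 Aker) rank1_scale.
Qed.

(** At x the equality reads <x, x> x = <x, y> y, and comparing quadratic forms
    at x gives |<x, y>| = <x, x>. *)
Lemma ketbra_same_ray x y : ketbra x = ketbra y -> same_ray x y.
Proof.
move=> xy; have E z : `|'[z, x]| ^+ 2 = `|'[z, y]| ^+ 2.
  by rewrite -!inner_ketbra xy.
have [x0|x0] := eqVneq x 0.
  exists 1; rewrite ?normr1// scale1r x0.
  apply/esym/inner_eq0/eqP; rewrite -normr_eq0 -sqrf_eq0 -E x0 inner0r.
  by rewrite normr0 expr0n.
have n0 := inner_neq0 x0.
exists ('[x, y] / '[x, x]).
  have /eqP : `|'[x, y]| ^+ 2 = `|'[x, x]| ^+ 2 by rewrite E.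
  rewrite eqrXn2// => /eqP eqn.
  by rewrite normrM normfV eqn divff// normr_eq0.
have /(congr1 (fun A => val A x)) := xy.
rewrite /= /rank1 !mul1r => /(congr1 (fun v => '[x, x]^-1 *: v)).
by rewrite !scalerA mulVf// scale1r mulrC.
Qed.

Section Preserver.
Variable phi : density_operators H -> density_operators H.
Hypothesis phi_bij : bijective phi.
Hypothesis phi_fidelity : forall A B,
  fidelity (val (phi A)) (val (phi B)) = fidelity (val A) (val B).

Lemma preserver_orthogonal A B :
  orthogonal_states (phi A) (phi B) = orthogonal_states A B.
Proof. by rewrite /orthogonal_states phi_fidelity. Qed.

Lemma preserver_minimal A : minimal_state A -> minimal_state (phi A).
Proof.
move=> [[B AB] minA]; have [psi phiK psiK] := phi_bij.
split; first by exists (phi B); rewrite preserver_orthogonal.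
move=> C [D CD] sub E CE.
rewrite -[E]psiK preserver_orthogonal; apply: (minA (psi C)).
- by exists (psi D); rewrite -preserver_orthogonal !psiK.
- move=> F AF; rewrite -preserver_orthogonal psiK; apply: sub.
  by rewrite preserver_orthogonal.
- by rewrite -preserver_orthogonal !psiK.
Qed.

(** For x = 0 the state is zero, which is the one orthogonal to all states. *)
Lemma preserver_ketbra x : exists y, phi (ketbra x) = ketbra y.
Proof.
have [x0|x0] := eqVneq x 0; last first.
  exact/minimal_rank1/preserver_minimal/minimal_ketbra.
exists 0; apply: val_inj; have [psi phiK psiK] := phi_bij.
rewrite [LHS]orthogonal_all => [|B].
  by apply/funext => z; rewrite /= /rank1 scaler0.
rewrite -[B]psiK preserver_orthogonal; apply/orthogonal_ketbra.
have /positive_psd[lB _ _] := density_positive (psi B).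
by rewrite x0 (linop0 lB).
Qed.

End Preserver.

End DensityOperators.

Section Conjugation.
Context {R : realType} {H : hilbertType R}.

(** As <A x, x> is real, it equals <V A x, V x> in the unitary and in the
    antiunitary case alike, and polarization applies to B V - V A and V. *)
Lemma conjugation_of_quadratic_form (V A B : H -> H) :
  unitary V \/ antiunitary V -> psd A -> linear B ->
  (forall x, '[B (V x), V x] = '[A x, x]) -> forall x, B (V x) = V (A x).
Proof.
move=> UV [lA sA pA] lB quad.
have VD : {morph V : x y / x + y}.
  move=> x y; case: UV => -[_ lV _]; first by rewrite (linopD lV).
  by rewrite -[x]scale1r lV conjC1 !scale1r.
have V0 : V 0 = 0 by apply: (addrI (V 0)); rewrite -VD !addr0.
have [j j2 Vi] : exists2 j : R[i], j ^+ 2 = -1 &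
    forall x, V ('i *: x) = j *: V x.
  case: UV => -[_ lV _].
    by exists 'i => [|x]; rewrite ?sqrCi ?(linopZ _ _ lV).
  exists (- 'i) => [|x]; first by rewrite sqrrN sqrCi.
  by rewrite -['i *: x]addr0 lV V0 addr0 conjCi.
have VA x : '[V (A x), V x] = '[A x, x].
  by case: UV => -[_ _ ->]; rewrite ?sA.
have Vonto y : exists x, V x = y.
  by case: UV => -[[W _ WK] _ _]; exists (W y).
move=> x; apply/eqP; rewrite -subr_eq0; apply/eqP; apply: inner_eq0.
pose T z := B (V z) - V (A z); rewrite -/(T x).
have [y Vy] := Vonto (T x); rewrite -{2}Vy.
apply: (polarization j2 _ VD _ Vi) => {x y Vy}.
- by move=> x y; rewrite /T VD (linopD lA) (linopD lB) VD opprD addrACA.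
- by move=> x; rewrite /T Vi (linopZ _ _ lA) (linopZ _ _ lB) Vi -scalerBr.
- by move=> x; rewrite /T innerBl quad VA subrr.
Qed.

End Conjugation.

(* Ustar is the inverse of U, that is U^* for U unitary or antiunitary. *)
Theorem theorem1 (R : realType) (H : hilbertType R)
    (phi : density_operators H -> density_operators H)
    (phi_bij : bijective phi)
    (phi_fidelity : forall A B : density_operators H,
       fidelity (val (phi A)) (val (phi B)) = fidelity (val A) (val B)) :
  exists U Ustar : H -> H,
    [/\ unitary U \/ antiunitary U,
        cancel U Ustar,
        cancel Ustar U
      & forall A : density_operators H,
          val (phi A) = U \o val A \o Ustar].
Proof.
have [f fE] := choice (preserver_ketbra phi_bij phi_fidelity).
have f_quad A x : '[val (phi A) (f x), f x] = '[val A x, x].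
  apply: (fidelity_rank1_inj (density_positive _) (density_positive _)).
  by rewrite -[RHS](phi_fidelity (ketbra x)) fE.
have f_inner x y : `|'[f x, f y]| = `|'[x, y]|.
  apply/eqP; rewrite -(eqrXn2 (isT : 0 < 2)%N)// -!inner_ketbra.
  by rewrite -fE f_quad.
have f_onto y : exists x, same_ray y (f x).
  have [psi phiK psiK] := phi_bij.
  have psi_bij : bijective psi by exists phi.
  have psi_fid A B : fidelity (val (psi A)) (val (psi B)) =
      fidelity (val A) (val B) by rewrite -phi_fidelity !psiK.
  have [x xE] := preserver_ketbra psi_bij psi_fid y.
  by exists x; apply: ketbra_same_ray; rewrite -fE -xE psiK.
have [V [Vinv [UV VK VinvK fV]]] := wigner f_inner f_onto.
exists V, Vinv; split=> // A; apply/funext => z; rewrite /= -{1}(VinvK z).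
have psdA := positive_psd (density_positive A).
have /positive_psd[lB _ _] := density_positive (phi A).
apply: (conjugation_of_quadratic_form UV psdA lB) => x.
have [p p1 fx] := fV x; rewrite -(f_quad A) fx (linopZ _ _ lB) innerZl innerZr.
by rewrite mulrA norm1_conj// mul1r.
Qed.
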